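(* Let $\mathcal{H}$ be a complex Hilbert space, let $S\in\mathcal{B}(\mathcal{H})$ be generalized Drazin invertible with closed range, and let $S^{-}$ be a fixed inner inverse of $S$. Suppose that $\|S^d\|\leq1$ and $$\lim_{n\to\infty}\left(S^{-}S^{n+1}S^d-S^{n+1}S^dS^{-}\right)=0.$$ Then, for $T\in\mathcal{B}(\mathcal{H})$, $S\leq^{GD-}T$ if and only if $S\leq^{d}T$.
   Context: $\mathcal{B}(\mathcal{H})$ is the space of bounded linear operators on $\mathcal{H}$; limits are in operator norm. An operator $Q$ is quasinilpotent if $\|Q^n\|^{1/n}\to0$. $S\in\mathcal{B}(\mathcal{H})$ is generalized Drazin invertible if there is $X\in\mathcal{B}(\mathcal{H})$ with $XSX=X$, $SX=XS$ and $S-S^2X$ quasinilpotent; such an $X$ is unique and is denoted $S^d$. An inner inverse of $S$ is $S^{-}\in\mathcal{B}(\mathcal{H})$ with $SS^{-}S=S$ (one exists iff the range of $S$ is closed). The GD1 inverse of $S$ associated with the fixed inner inverse $S^{-}$ is $S^{GD-}=S^dSS^{-}$. The relation $S\leq^{GD-}T$ means $SS^{GD-}=TS^{GD-}$ and $S^{GD-}S=S^{GD-}T$. The relation $S\leq^{d}T$ means $SS^d=TS^d$ and $S^dS=S^dT$ (equivalently $S^dT=S^dS=TS^d$). *)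

(* Defs.v *)
From HB Require Import structures.
From mathcomp Require Import all_boot all_order all_algebra.
From mathcomp Require Import sesquilinear complex.
From mathcomp Require Import all_classical all_reals all_analysis.

Set Implicit Arguments.
Unset Strict Implicit.
Unset Printing Implicit Defensive.

Import Order.TTheory GRing.Theory Num.Theory.
Import numFieldNormedType.Exports.

Local Open Scope classical_set_scope.
Local Open Scope complex_scope.
Local Open Scope ring_scope.

(* The inner product is linear in its first argument. *)
HB.mixin Record isHilbert (R : realType) (H : Type)
    of CompleteNormedModule R[i] H := {
  hdot : {dot H for (@Num.conj R[i])} ;
  hdot_norm : forall x : H, hdot x x = `|x| ^+ 2
}.

#[short(type="hilbertType")]
HB.structure Definition Hilbert (R : realType) :=
  { H of CompleteNormedModule R[i] H & isHilbert R H }.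

Section BoundedOperators.
Context {R : realType} {H : hilbertType R}.

Definition bounded_linear : {pred H -> H} :=
  fun f => `[< linear f /\ exists M : R, forall x, `|f x| <= M%:C * `|x| >].

Lemma bounded_linearP (f : H -> H) :
  reflect (linear f /\ exists M : R, forall x, `|f x| <= M%:C * `|x|)
          (f \in bounded_linear).
Proof. exact: asboolP. Qed.

Lemma bounded_linear_submod : submod_closed bounded_linear.
Proof.
split.
  apply/bounded_linearP; split=> [a x y|]; first by rewrite scaler0 addr0.
  by exists 0 => x; rewrite normr0 mul0r.
move=> a f g /bounded_linearP[lf [M fM]] /bounded_linearP[lg [N gN]].
apply/bounded_linearP; split=> [b x y|].
  rewrite !fctE /= lf lg !scalerDr !scalerA (mulrC a b) -!addrA.
  by congr (_ + _); rewrite addrCA.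
exists (complex.Re `|a| * M + N) => x; rewrite !fctE /=.
apply: le_trans (ler_normD _ _) _.
rewrite rmorphD rmorphM /= mulrDl lerD// normrZ.
by rewrite -mulrA ler_wpM2l.
Qed.

HB.instance Definition _ :=
  GRing.isSubmodClosed.Build R[i] (H -> H) bounded_linear
    bounded_linear_submod.

Record bop := BOp { bop_fun :> H -> H ; _ : bop_fun \in bounded_linear }.

HB.instance Definition _ := [isSub for bop_fun].
HB.instance Definition _ := [Choice of bop by <:].
HB.instance Definition _ := [SubChoice_isSubLmodule of bop by <:].

Implicit Types S T X Y Z : bop.

Lemma bop_linear S : linear S.
Proof. by case: S => f /= /bounded_linearP[]. Qed.

HB.instance Definition _ S :=
  GRing.isLinear.Build R[i] H H *:%R S (bop_linear S).

Lemma bop_bounded S : exists M : R, forall x, `|S x| <= M%:C * `|x|.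
Proof. by case: S => f /= /bounded_linearP[]. Qed.

Lemma bopP S T : S = T <-> forall x, S x = T x.
Proof. by split=> [->//|ST]; apply/val_inj/funext. Qed.

Lemma idfun_bounded_linear : @idfun H \in bounded_linear.
Proof.
by apply/bounded_linearP; split=> //; exists 1 => x; rewrite mul1r.
Qed.

Lemma comp_bounded_linear S T : S \o T \in bounded_linear.
Proof.
apply/bounded_linearP; split=> [a x y|]; first by rewrite /= !linearP.
have [M SM] := bop_bounded S; have [N TN] := bop_bounded T.
exists (`|M| * N) => x /=; apply: le_trans (SM _) _.
apply: (@le_trans _ _ (`|M|%:C * `|T x|)).
  by rewrite ler_wpM2r// lecR ler_norm.
by rewrite rmorphM /= -mulrA ler_wpM2l// lecR.
Qed.

Definition bop_one : bop := BOp idfun_bounded_linear.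
Definition bop_mul S T : bop := BOp (comp_bounded_linear S T).

Fact bop_mulA : associative bop_mul. Proof. by move=> S T X; exact/bopP. Qed.
Fact bop_mul1 : left_id bop_one bop_mul. Proof. by move=> S; exact/bopP. Qed.
Fact bop_mulr1 : right_id bop_one bop_mul. Proof. by move=> S; exact/bopP. Qed.
Fact bop_mulDl : left_distributive bop_mul +%R.
Proof. by move=> S T X; exact/bopP. Qed.
Fact bop_mulDr : right_distributive bop_mul +%R.
Proof. by move=> S T X; apply/bopP => x; exact: (linearD S). Qed.

(* [pzRing]: the zero space is a Hilbert space, and then 1 = 0. *)
HB.instance Definition _ := GRing.Zmodule_isPzRing.Build bop
  bop_mulA bop_mul1 bop_mulr1 bop_mulDl bop_mulDr.

(* Norms of vectors are elements of R[i], norms of operators are elements of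
   R. *)
Definition opnorm S : R :=
  sup [set complex.Re `|S x| | x in [set x : H | `|x| <= 1]].

Lemma Re_normK (x : H) : (complex.Re `|x|)%:C = `|x|.
Proof. by rewrite RRe_real// normr_real. Qed.

Let opnorm_has_sup S :
  has_sup [set complex.Re `|S x| | x in [set x : H | `|x| <= 1]].
Proof.
split; first by exists (complex.Re `|S 0|), 0 => //=; rewrite normr0.
have [M SM] := bop_bounded S; exists `|M| => _ [x /= x1 <-].
rewrite -lecR Re_normK; apply: le_trans (SM x) _.
apply: (@le_trans _ _ (`|M|%:C * `|x|)).
  by rewrite ler_wpM2r// lecR ler_norm.
by rewrite ler_piMr// lecR.
Qed.

Lemma opnorm_ge0 S : 0 <= opnorm S.
Proof.
apply: (ub_le_sup (opnorm_has_sup S).2).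
by exists 0 => /=; rewrite ?linear0 normr0.
Qed.

Lemma ler_opnorm S x : `|S x| <= (opnorm S)%:C * `|x|.
Proof.
have [->|x0] := eqVneq x 0; first by rewrite linear0 !normr0 mulr0.
have nx0 : 0 < `|x| by rewrite normr_gt0.
rewrite -ler_pdivrMr// mulrC -[X in X * _]gtr0_norm ?invr_gt0// -normrZ.
have -> : `|x|^-1 *: S x = S (`|x|^-1 *: x) by rewrite linearZ.
rewrite -[X in X <= _]Re_normK lecR.
apply: (ub_le_sup (opnorm_has_sup S).2); exists (`|x|^-1 *: x) => //=.
by rewrite normrZ gtr0_norm ?invr_gt0// mulVf// gt_eqF.
Qed.

Lemma opnorm_le S (M : R) : 0 <= M ->
  (forall x, `|S x| <= M%:C * `|x|) -> opnorm S <= M.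
Proof.
move=> M0 SM; apply: (ge_sup (opnorm_has_sup S).1) => _ [x /= x1 <-].
rewrite -lecR Re_normK; apply: le_trans (SM x) _.
by rewrite ler_piMr// lecR.
Qed.

Lemma opnormM S T : opnorm (S * T) <= opnorm S * opnorm T.
Proof.
apply: opnorm_le => [|x]; first by rewrite mulr_ge0// opnorm_ge0.
apply: le_trans (ler_opnorm S (T x)) _.
by rewrite rmorphM /= -mulrA ler_wpM2l ?lecR ?opnorm_ge0// ler_opnorm.
Qed.

Fact ler_opnormD S T : opnorm (S + T) <= opnorm S + opnorm T.
Proof.
apply: opnorm_le => [|x]; first by rewrite addr_ge0// opnorm_ge0.
apply: le_trans (ler_normD (S x) (T x)) _.
by rewrite rmorphD /= mulrDl lerD// ler_opnorm.
Qed.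

Fact opnorm0_eq0 S : opnorm S = 0 -> S = 0.
Proof.
move=> S0; apply/bopP => x; apply/eqP; rewrite -normr_le0.
by rewrite (le_trans (ler_opnorm S x))// S0 mul0r.
Qed.

Lemma bopMn S n x : (S *+ n) x = S x *+ n.
Proof. by elim: n => // n IHn; rewrite !mulrS -IHn. Qed.

Fact opnormMn S n : opnorm (S *+ n) = opnorm S *+ n.
Proof.
apply/eqP; rewrite eq_le; apply/andP; split.
  apply: opnorm_le => [|x]; first by rewrite mulrn_wge0// opnorm_ge0.
  by rewrite bopMn normrMn rmorphMn /= mulrnAl lerMn2r ler_opnorm orbT.
case: n => [|n]; first by rewrite mulr0n opnorm_ge0.
rewrite -mulr_natr -ler_pdivlMr ?ltr0n//.
apply: opnorm_le => [|x]; first by rewrite divr_ge0// opnorm_ge0.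
rewrite rmorphM fmorphV rmorph_nat /= mulrAC ler_pdivlMr ?ltr0n//.
by rewrite mulr_natr -normrMn -bopMn ler_opnorm.
Qed.

Fact opnormN S : opnorm (- S) = opnorm S.
Proof.
by congr sup; apply/seteqP; split=> _ [x x1 <-]; exists x => //=; rewrite normrN.
Qed.

HB.instance Definition _ := Num.Zmodule_isNormed.Build R bop
  ler_opnormD opnorm0_eq0 opnormMn opnormN.
HB.instance Definition _ := PseudoMetric.copy bop (pseudoMetric_normed bop).
HB.instance Definition _ := isPointed.Build bop 0.
HB.instance Definition _ := NormedZmod_PseudoMetric_eq.Build R bop erefl.

Lemma bop_normE S : `|S| = opnorm S. Proof. by []. Qed.

Lemma bop_normM S T : `|S * T| <= `|S| * `|T|.
Proof. exact: opnormM. Qed.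

Definition quasinilpotent (Q : bop) : Prop :=
  `|Q ^+ n| `^ n%:R^-1 @[n --> \oo] --> (0 : R).

Definition gdrazin_inverse S X : Prop :=
  [/\ X * S * X = X, S * X = X * S & quasinilpotent (S - S ^+ 2 * X)].

Definition gdrazin_invertible S : Prop := exists X, gdrazin_inverse S X.

(* Junk value [0] when [S] is not generalized Drazin invertible; otherwise
   [gdrazin_inverse S X <-> X = gdrazin S] by the two lemmas below. *)
Definition gdrazin S : bop := xget 0 [set X | gdrazin_inverse S X].

Lemma gdrazinP S : gdrazin_invertible S -> gdrazin_inverse S (gdrazin S).
Proof. by case=> X SX; exact: (xgetI 0 SX). Qed.

Let normX S n : `|S ^+ n| <= `|S| ^+ n.
Proof.
elim: n => [|n IHn].
  by rewrite !expr0; apply: opnorm_le => // x; rewrite mul1r.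
by rewrite !exprS; apply: le_trans (bop_normM _ _) _; rewrite ler_wpM2l.
Qed.

Let quasinilpotent_eq0 Q X Z : quasinilpotent Q ->
  (forall n, `|Z| <= `|X| ^+ n.+1 * `|Q ^+ n.+1|) -> Z = 0.
Proof.
move=> /cvgrPdist_lt Q0 ZXQ; apply/eqP; rewrite -normr_le0.
pose e : R := (2 * (`|X| + 1))^-1.
have e0 : 0 < e by rewrite invr_gt0 mulr_gt0// ltr_wpDl.
have Xe : `|X| * e <= 2^-1.
  by rewrite /e invfM mulrCA ler_piMr// ler_pdivrMr ?mul1r ?lerDl// ltr_wpDl.
have geo : geometric 1 2^-1 n @[n --> \oo] --> (0 : R).
  by apply: cvg_geometric; rewrite ger0_norm// invf_lt1// ltr1n.
apply/ler_addgt0Pr => d d0; rewrite add0r.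
have [N _ QN] := Q0 e e0; have [M _ GM] := (cvgrPdist_lt _ _).1 geo d d0.
pose n := maxn N M.
have := GM n.+1 (leq_trans (leq_maxr N M) (leqnSn n)).
rewrite sub0r normrN => /ltW; apply: le_trans; apply: le_trans (ler_norm _).
have := QN n.+1 (leq_trans (leq_maxl N M) (leqnSn n)).
rewrite sub0r normrN ger0_norm ?powR_ge0// => Qe.
rewrite /geometric /= mul1r; apply: le_trans (ZXQ n) _.
have -> : `|Q ^+ n.+1| = (`|Q ^+ n.+1| `^ n.+1%:R^-1) ^+ n.+1.
  by rewrite -powR_mulrn ?powR_ge0// -powRrM mulVf ?powRr1// pnatr_eq0.
by rewrite -exprMn lerXn2r// ?nnegrE ?mulr_ge0 ?powR_ge0//
  (le_trans _ Xe)// ler_wpM2l// ltW.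
Qed.

Lemma gdrazin_unique S X Y :
  gdrazin_inverse S X -> gdrazin_inverse S Y -> X = Y.
Proof.
move=> [XSX SX SXq] [YSY SY SYq].
have idem (P : bop) n : P * P = P -> P ^+ n.+1 = P.
  by move=> PP; elim: n => // n IHn; rewrite exprS IHn.
have idemC (P : bop) : P * P = P -> (1 - P) * (1 - P) = 1 - P.
  by move=> PP; rewrite mulrBl mul1r mulrBr mulr1 PP subrr subr0.
have SXS : (S * X) * (S * X) = S * X by rewrite -mulrA (mulrA X) XSX.
have SYS : (S * Y) * (S * Y) = S * Y by rewrite -mulrA (mulrA Y) YSY.
have commS Z : S * Z = Z * S -> GRing.comm S (1 - S * Z).
  move=> SZ; apply: commrB; first exact: commr1.
  by apply: commrM; [exact: commr_refl|exact: SZ].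
have resE Z n : S * Z = Z * S -> (S * Z) * (S * Z) = S * Z ->
    (S - S ^+ 2 * Z) ^+ n.+1 = S ^+ n.+1 * (1 - S * Z).
  move=> SZ ZZ; have -> : S - S ^+ 2 * Z = S * (1 - S * Z).
    by rewrite mulrBr mulr1 mulrA.
  rewrite exprMn_comm; last exact: commS.
  by congr (_ * _); apply: idem; exact: idemC.
have XY0 : S * X * (1 - S * Y) = 0.
  apply: (@quasinilpotent_eq0 _ X _ SYq) => n.
  rewrite -(idem (S * X) n SXS) SX exprMn_comm// -mulrA -resE//.
  by apply: le_trans (bop_normM _ _) _; rewrite ler_wpM2r.
have YX0 : (1 - S * X) * (S * Y) = 0.
  apply: (@quasinilpotent_eq0 _ Y _ SXq) => n.
  rewrite -(idem (S * Y) n SYS) exprMn_comm// mulrA.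
  rewrite (commrX n.+1 (commr_sym (commS X SX))) -resE//.
  by apply: le_trans (bop_normM _ _) _; rewrite mulrC ler_wpM2r.
have XY : S * X = S * X * (S * Y).
  by apply/eqP; rewrite -subr_eq0 -{1}[S * X]mulr1 -mulrBr XY0.
have YX : S * Y = S * X * (S * Y).
  by apply/eqP; rewrite -subr_eq0 -{1}[S * Y]mul1r -mulrBl YX0.
have SXY : S * X = S * Y by rewrite YX -XY.
by rewrite -XSX -mulrA SXY mulrA -SX SXY SY YSY.
Qed.

Definition inner_inverse S (Sm : bop) : Prop := S * Sm * S = S.

Definition gd1 S (Sm : bop) : bop := gdrazin S * S * Sm.

(* [S <=^{GD-} T], for the inner inverse [Sm] of [S]. *)
Definition le_gd1 S (Sm : bop) T : Prop :=
  S * gd1 S Sm = T * gd1 S Sm /\ gd1 S Sm * S = gd1 S Sm * T.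

(* [S <=^d T]. *)
Definition le_gdrazin S T : Prop :=
  S * gdrazin S = T * gdrazin S /\ gdrazin S * S = gdrazin S * T.

End BoundedOperators.

Arguments bop {R} H.

(* Main.v *)
(* Write P := S S^d = S^d S and let A_n be the n-th term of the vanishing
   sequence. Then (S^d)^n A_n (1 - P) = - P S^- (1 - P) for every n, and as
   ||(S^d)^n B|| <= ||B|| the limit forces P S^- (1 - P) = 0. Hence
   S^{GD-} = P S^- = P S^- P = S^d (S S^- S) S^d = S^d S S^d = S^d, so that the
   two relations coincide. *)
Require Import Defs.
From HB Require Import structures.
From mathcomp Require Import all_boot all_order all_algebra.
From mathcomp Require Import sesquilinear complex.
From mathcomp Require Import all_classical all_reals all_analysis.

Set Implicit Arguments.
Unset Strict Implicit.
Unset Printing Implicit Defensive.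

Import Order.TTheory GRing.Theory Num.Theory.
Import numFieldNormedType.Exports.

Local Open Scope classical_set_scope.
Local Open Scope ring_scope.

Lemma gd1_eq_gdrazin (R : realType) (H : hilbertType R) (S Sm : bop H) :
  gdrazin_invertible S -> inner_inverse S Sm -> `|gdrazin S| <= 1 ->
  (Sm * S ^+ n.+1 * gdrazin S - S ^+ n.+1 * gdrazin S * Sm)
    @[n --> \oo] --> (0 : bop H) ->
  gd1 S Sm = gdrazin S.
Proof.
move=> /gdrazinP[]; rewrite /gd1; set X := gdrazin S => XSX SX _ SSmS X1 limA.
pose A n := Sm * S ^+ n.+1 * X - S ^+ n.+1 * X * Sm.
pose P := X * S; pose Z := P * Sm * (1 - P).
have XXS : X * (X * S) = X by rewrite -SX mulrA XSX.
have XP0 : X * (1 - P) = 0 by rewrite mulrBr mulr1 XXS subrr.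
have XnSnX n : X ^+ n * (S ^+ n.+1 * X) = P.
  elim: n => [|n IHn]; first by rewrite mul1r expr1 SX.
  rewrite exprSr exprS -!mulrA (mulrA X S).
  (* The idempotent [X * S] commutes with powers of [S] and fixes [X], so it is absorbed. *)
  have -> : X * S * (S ^+ n.+1 * X) = S ^+ n.+1 * X.
    have SnP : GRing.comm (X * S) (S ^+ n.+1).
      by apply: commrX; rewrite /GRing.comm -SX -mulrA -SX.
    by rewrite mulrA SnP -mulrA XSX.
  exact: IHn.
(* The first term of [A n] ends in [X], which [1 - P] kills from the right; [XnSnX] turns the second
   into [- P * Sm]. *)
have ZE n : X ^+ n * A n * (1 - P) = - Z.
  rewrite (mulrBr (X ^+ n)) mulrBl (mulrA _ _ Sm) XnSnX.
  by rewrite -(mulrA (X ^+ n)) -(mulrA _ X) XP0 !mulr0 sub0r.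
(* Carrying the factor [B] lets the induction start without the norm of [1], which is 0 on the zero
   space. *)
have Xn n (B : bop H) : `|X ^+ n * B| <= `|B|.
  elim: n B => [|n IHn] B; first by rewrite mul1r.
  rewrite exprSr -mulrA (le_trans (IHn _))// (le_trans (bop_normM _ _))//.
  by rewrite ler_piMl.
(* [Z] is independent of [n], so the vanishing bound [|A n| * |1 - P|] forces it to be 0. *)
have Z0 : `|Z| <= 0.
  have A0 : `|A n| * `|1 - P| @[n --> \oo] --> (0 : R).
    rewrite -(mul0r `|1 - P|) -(normr0 (bop H)).
    by apply: cvgMr_tmp; apply: cvg_norm.
  rewrite -(cvg_lim _ A0)//; apply: limr_ge; first by apply/cvg_ex; exists 0.
  apply: nearW => n; rewrite -normrN -(ZE n) (le_trans (bop_normM _ _))//.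
  by rewrite ler_wpM2r.
have PSmP : P * Sm = P * Sm * P.
  by apply/eqP; rewrite -subr_eq0 -{1}[P * Sm]mulr1 -mulrBr -normr_le0.
(* The right-hand [P] is written [S * X] to expose [S * Sm * S]. *)
by rewrite -/P PSmP {2}/P -SX /P mulrA -(mulrA X S Sm) -(mulrA X) SSmS.
Qed.

Theorem theorem11 (R : realType) (H : hilbertType R) (S Sm : bop H)
  (S_gdrazin : gdrazin_invertible S)
  (S_closed_range : closed (range S))
  (Sm_inner : inner_inverse S Sm)
  (Sd_norm : `|gdrazin S| <= 1)
  (limS : (Sm * S ^+ n.+1 * gdrazin S - S ^+ n.+1 * gdrazin S * Sm)
            @[n --> \oo] --> (0 : bop H))
  (T : bop H) :
  le_gd1 S Sm T <-> le_gdrazin S T.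
Proof. by rewrite /le_gd1 gd1_eq_gdrazin. Qed.
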